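(* Let $a,b,c$ be integers and let $P=P(a,b,c)$ be the pretzel link diagram with three entries. (1) Suppose $b$ is even and $b\neq 0$. Then $P$ is the closure $\hat\beta$ of the braid $$\beta = 1^{c}\; s_b\Big[-2 \downarrow -\tfrac{|b|}{2}-1\Big]\; 1^{a}\; s_b\Big(\Big[2 \uparrow \tfrac{|b|}{2}\Big]\,\Big[-\tfrac{|b|}{2}-1 \uparrow -2\Big]\Big),$$ which has $|a|+|c|+\frac{3|b|}{2}-1$ crossings and $\frac{|b|}{2}+2$ strands. (2) Suppose $a,b,c$ are all odd, and put $a'=\frac{|a|-1}{2}$, $b'=\frac{|b|-1}{2}$, $c'=\frac{|c|-1}{2}$. Then $P=\hat\beta$ where $$\begin{array}{rcl} \beta &=& [b'+c'+2 \downarrow b'+3]^{\uparrow a' \uparrow}\\ && s_a\big([-b'-2 \downarrow -b'-a'-1]\,[b'+1 \uparrow b'+a']\,[-b'-a'-1 \uparrow -b'-1]\big)\\ && [-b'-a'-2 \uparrow -b'-3]^{\downarrow c' \downarrow}\\ && s_b\big([-b' \uparrow -1]\,[-1 \downarrow -b'-1]\,[1 \uparrow b']\big)\\ && s_c\big([-b'-2 \downarrow -b'-c'-1]\,[b'+1 \uparrow b'+c']\,[-b'-c'-1 \uparrow -b'-1]\big), \end{array}$$ and this braid has $|a|+|c|-1+\frac{3|b|+|ac|}{2}$ crossings and $\frac{|a|+|b|+|c|+1}{2}$ strands.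
   Context: Pretzel diagram: for integers $a_1,\dots,a_n$, $P(a_1,\dots,a_n)$ is the link diagram formed by $n$ vertical two-strand twist columns placed side by side from left to right, the $i$-th column consisting of $|a_i|$ crossings all of the same type, that type being determined by the sign $a_i/|a_i|$ (no crossings if $a_i=0$); the top-right end of column $i$ is joined to the top-left end of column $i+1$ and likewise at the bottom, and the top-left end of column $1$ is joined to the top-right end of column $n$ by an arc running over the top (a ''top horizontal line''), and likewise at the bottom. Crossing-sign and braid-generator conventions are the standard ones of Lickorish's book, under which e.g. $P(a,b)$ is the closure of $\sigma_1^{a+b}$. ''$P=\hat\beta$'' means the link represented by $P$ is isotopic to the closure of the braid $\beta$. Braid-word notation: a sequence of nonzero integers $(m_1,\dots,m_k)$ denotes the braid word $\sigma_{|m_1|}^{\epsilon_1}\cdots\sigma_{|m_k|}^{\epsilon_k}$ with $\epsilon_i=m_i/|m_i|$; juxtaposition is concatenation. For a positive integer $k$ and an integer $e$, $k^{e}$ denotes $\sigma_k^{e}$. For integers $i,j$: $[i\uparrow j]=(i,i+1,\dots,j)$ if $i\le j$ and $ij>0$, and is the empty word otherwise; $[i\downarrow j]=(i,i-1,\dots,j)$ if $i\ge j$ and $ij>0$, and is empty otherwise. For a nonzero integer $a$, $s_a=a/|a|$, and $s_a(m_1,\dots,m_k)=(s_am_1,\dots,s_am_k)$ (applied to concatenations termwise). For $m\ge 0$ and $X\in\{[i\uparrow j],[i\downarrow j]\}$: $X^{\downarrow m\downarrow}$ is the concatenation of the $m$ words obtained from $X$ by subtracting $0,1,\dots,m-1$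 from both endpoints $i,j$ (e.g. $[i\uparrow j]^{\downarrow m\downarrow}=[i\uparrow j][i-1\uparrow j-1]\cdots[i-m+1\uparrow j-m+1]$), and $X^{\uparrow m\uparrow}$ is the analogous concatenation adding $0,1,\dots,m-1$ to both endpoints; each group is interpreted with the emptiness rule above (e.g. $[-3\uparrow-1]^{\uparrow2\uparrow}=[-3\uparrow-1][-2\uparrow0]=(-3,-2,-1)$); both are empty if $m=0$. *)

(* Defs.v *)
From mathcomp Require Import all_boot all_order all_algebra.
Set Implicit Arguments. Unset Strict Implicit. Unset Printing Implicit Defensive.
Import Order.TTheory GRing.Theory Num.Theory.
Local Open Scope ring_scope.

(* Link diagrams in Morse (sliced) form.                                     *)
(* A diagram is a word of elementary slices read from bottom to top; each    *)
(* slice acts on a horizontal row of points, leaving the [p] leftmost points *)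
(* untouched:                                                                *)
(*  (Cup, p)  : creates two new adjacent points at positions p, p+1 joined   *)
(*              by a minimum;                                                *)
(*  (Cap, p)  : joins the points at positions p, p+1 by a maximum;           *)
(*  (Xp, p)   : crossing of the strands at positions p, p+1 in which the     *)
(*              strand going from bottom-left to top-right passes OVER;      *)
(*  (Xn, p)   : the other crossing (that strand passes UNDER).               *)
(* With braids drawn upwards, sigma_i is (Xp, i-1) (positive crossing).      *)

Inductive gen := Cup | Cap | Xp | Xn.

Definition slice := (gen * nat)%type.

Definition gin (g : gen) : nat := match g with Cup => 0 | Cap => 2 | _ => 2 end%N.
Definition gout (g : gen) : nat := match g with Cup => 2 | Cap => 0 | _ => 2 end%N.

Fixpoint wf_from (n : nat) (w : seq slice) : option nat :=
  match w with
  | [::] => Some n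
  | (g, p) :: w' =>
      if (p + gin g <= n)%N then wf_from (n - gin g + gout g)%N w' else None
  end.

Definition link_word (w : seq slice) : Prop := wf_from 0 w = Some 0%N.

(* Local moves (planar isotopies of Morse diagrams and Reidemeister moves). *)
Inductive lmove : seq slice -> seq slice -> Prop :=
  | lm_far g h p q : (p + gout g <= q)%N ->
      lmove [:: (g, p); (h, q)] [:: (h, (q - gout g + gin g)%N); (g, p)]
  | lm_zig1 i : lmove [:: (Cup, i); (Cap, i.+1)] [::]
  | lm_zig2 i : lmove [:: (Cup, i.+1); (Cap, i)] [::]
  | lm_r2a i : lmove [:: (Xp, i); (Xn, i)] [::]
  | lm_r2b i : lmove [:: (Xn, i); (Xp, i)] [::]
  | lm_r3p i : lmove [:: (Xp, i); (Xp, i.+1); (Xp, i)] [:: (Xp, i.+1); (Xp, i); (Xp, i.+1)]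
  | lm_r3n i : lmove [:: (Xn, i); (Xn, i.+1); (Xn, i)] [:: (Xn, i.+1); (Xn, i); (Xn, i.+1)]
  | lm_r1cup x i : (x = Xp \/ x = Xn) -> lmove [:: (Cup, i); (x, i)] [:: (Cup, i)]
  | lm_r1cap x i : (x = Xp \/ x = Xn) -> lmove [:: (x, i); (Cap, i)] [:: (Cap, i)]
  | lm_cupL x i : (x = Xp \/ x = Xn) ->
      lmove [:: (Cup, i); (x, i.+1); (x, i)] [:: (Cup, i.+1)]
  | lm_cupR x i : (x = Xp \/ x = Xn) ->
      lmove [:: (Cup, i.+1); (x, i); (x, i.+1)] [:: (Cup, i)]
  | lm_capR x i : (x = Xp \/ x = Xn) ->
      lmove [:: (x, i); (x, i.+1); (Cap, i)] [:: (Cap, i.+1)]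
  | lm_capL x i : (x = Xp \/ x = Xn) ->
      lmove [:: (x, i.+1); (x, i); (Cap, i.+1)] [:: (Cap, i)].

Inductive isotopic : seq slice -> seq slice -> Prop :=
  | iso_refl w : isotopic w w
  | iso_sym w1 w2 : isotopic w1 w2 -> isotopic w2 w1
  | iso_trans w1 w2 w3 : isotopic w1 w2 -> isotopic w2 w3 -> isotopic w1 w3
  | iso_move l u v r : lmove u v ->
      link_word (l ++ u ++ r) -> link_word (l ++ v ++ r) ->
      isotopic (l ++ u ++ r) (l ++ v ++ r).

(* Pretzel diagrams P(a_1,...,a_n): bottom horizontal arcs, n vertical twist *)
(* columns (column i on positions 2i, 2i+1; |a_i| crossings of type Xp if    *)
(* a_i > 0, Xn if a_i < 0), top horizontal arcs.                             *)

Definition xtype (a : int) : gen := if 0 < a then Xp else Xn.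

Definition pretzel (l : seq int) : seq slice :=
  let n := size l in
  (Cup, 0%N) :: nseq n.-1 (Cup, 1%N)
  ++ flatten [seq nseq `|a.2|%N (xtype a.2, (2 * a.1)%N) | a <- zip (iota 0 n) l]
  ++ rcons (nseq n.-1 (Cap, 1%N)) (Cap, 0%N).

(* Braid words: a sequence of nonzero integers m denotes sigma_|m|^(sign m). *)
(* Closure on n strands (return arcs on the right).                          *)

Definition braid_word := seq int.

Definition is_braid (n : nat) (b : braid_word) : bool :=
  all (fun m => (0 < `|m|)%N && (`|m| < n)%N) b.

Definition closure (n : nat) (b : braid_word) : seq slice :=
  [seq (Cup, j) | j <- iota 0 n]
  ++ [seq (xtype m, (`|m|).-1) | m <- b]
  ++ [seq (Cap, j) | j <- rev (iota 0 n)].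

Definition is_closure (P : seq slice) (n : nat) (b : braid_word) : Prop :=
  is_braid n b /\ isotopic P (closure n b).

Definition bup (i j : int) : braid_word :=
  if (i <= j) && (0 < i * j) then [seq i + k%:Z | k <- iota 0 `|j - i|.+1] else [::].
Definition bdown (i j : int) : braid_word :=
  if (j <= i) && (0 < i * j) then [seq i - k%:Z | k <- iota 0 `|i - j|.+1] else [::].

(* X^{↑m↑} and X^{↓m↓}, X given by its constructor (bup or bdown) and endpoints *)
Definition shift_up (X : int -> int -> braid_word) (i j : int) (m : nat) : braid_word :=
  flatten [seq X (i + k%:Z) (j + k%:Z) | k <- iota 0 m].
Definition shift_down (X : int -> int -> braid_word) (i j : int) (m : nat) : braid_word :=
  flatten [seq X (i - k%:Z) (j - k%:Z) | k <- iota 0 m].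

Definition sgnz (a : int) : int := if 0 < a then 1 else -1.
Definition sscale (a : int) (w : braid_word) : braid_word := [seq sgnz a * m | m <- w].

Definition bpow (k : nat) (e : int) : braid_word := nseq `|e|%N (sgnz e * k%:Z).

(* Main.v *)
Require Import Defs.
From mathcomp Require Import all_boot all_order all_algebra.
From mathcomp Require Import zify.
Import Order.TTheory GRing.Theory Num.Theory.

Set Implicit Arguments. Unset Strict Implicit. Unset Printing Implicit Defensive.

(* The braid is taken apart by pulling its return arcs through the diagram.    *)
(* A run s_b([-p-2 ↓ -p-h-1] [p+1 ↑ p+h] [-p-h-1 ↑ -p-1]) whose last h strands *)
(* are closed up unrolls, two crossings per strand, into a horizontal twist    *)
(* with 2h+1 crossings ([trace_coil]). In the odd case the two stacks of       *)
(* a'c' crossings around the a-run only carry its return arcs over the strands *)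
(* of the c-run ([carry]), while the b-run is a spiral that is unwound by      *)
(* swinging return arcs around the diagram ([unspool]). What remains is a      *)
(* vertical stack of three horizontal twists closed on two strands, which is   *)
(* the pretzel diagram turned by a quarter turn.                               *)

(** In both braids most strands only store crossings of a twist column. A horizontal twist with one
    crossing is a braid crossing of the other type ([H1]), and enclosing a twist in one more strand,
    closed on the right, lengthens it by two ([traceR]). Hence a coil with h closed strands is a
    twist with 2h+1 crossings ([trace_coil]), so an odd entry of absolute value 2h+1 costs h
    strands. For even b the coil gives |b|-1 crossings, the first letter of the first b-run gives
    the last one, and three strands remain ([coil_even_pretzel]). For odd entries the a-coil is
    separated from the c strands ([trace_carried]), both coils are unrolled, and the spiral becomes
    a twist with 2b'+1 crossings ([unspool]); the remaining stack of twists is the pretzel diagram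
    ([closure2_pretzel]). The only nonlocal argument is that a strand running entirely over, or
    entirely under, a tangle can be moved across it ([slide]). Swinging a return arc around a
    diagram and carrying a coil past other strands both follow from it. *)

Definition X (s : bool) : gen := if s then Xp else Xn.

(** * Well-formed words and their equivalence *)

Lemma ginX s : gin (X s) = 2. Proof. by case: s. Qed.
Lemma goutX s : gout (X s) = 2. Proof. by case: s. Qed.
Lemma XP s : X s = Xp \/ X s = Xn. Proof. by case: s; [left | right]. Qed.

Lemma wf_cat n u v : wf_from n (u ++ v) = obind (wf_from^~ v) (wf_from n u).
Proof. by elim: u n => [|[g p] u IH] n //=; case: ifP. Qed.

Lemma wf_X n s p w : p.+2 <= n -> wf_from n ((X s, p) :: w) = wf_from n w.
Proof. by move=> h; rewrite /= ginX goutX addn2 h subnK // (leq_trans _ h). Qed.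

Lemma wf_Cup n p w : p <= n -> wf_from n ((Cup, p) :: w) = wf_from n.+2 w.
Proof. by move=> h /=; rewrite addn0 h subn0 addn2. Qed.

Lemma wf_Cap n p w : p <= n -> wf_from n.+2 ((Cap, p) :: w) = wf_from n w.
Proof. by move=> h /=; rewrite addn2 !ltnS h addn0 !subSS subn0. Qed.

(* Both sides of a move may be ill-formed: then the relation says nothing,   *)
(* so that well-formedness has to be checked only once, at the very end.     *)
Inductive teq (n : nat) : seq slice -> seq slice -> Prop :=
  | teq_refl w : teq n w w
  | teq_sym u v : teq n u v -> teq n v u
  | teq_trans u v w : teq n u v -> teq n v w -> teq n u w
  | teq_move l u v r : lmove u v ->
      wf_from n (l ++ u ++ r) = wf_from n (l ++ v ++ r) ->
      teq n (l ++ u ++ r) (l ++ v ++ r).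

Hint Resolve teq_refl : core.

Lemma teq_wf n u v : teq n u v -> wf_from n u = wf_from n v.
Proof. by elim=> [||? ? ? _ -> _ ->|] //. Qed.

Lemma teq_isotopic u v : teq 0 u v -> link_word u -> isotopic u v.
Proof.
elim=> {u v} [w|u v e IH|u v w e1 IH1 e2 IH2|l u v r m e] hl.
- exact: iso_refl.
- by apply/iso_sym/IH; rewrite /link_word (teq_wf e).
- by apply: iso_trans (IH1 hl) (IH2 _); rewrite /link_word -(teq_wf e1).
- by apply: iso_move => //; rewrite /link_word -e.
Qed.

Lemma teq_cons n g p u v :
  teq (n - gin g + gout g) u v -> teq n ((g, p) :: u) ((g, p) :: v).
Proof.
elim=> {u v} [w|u v _|u v w _ e1 _ e2|l u v r m e]; first exact: teq_refl.
- exact: teq_sym.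
- exact: teq_trans e1 e2.
- by apply: (@teq_move _ ((g, p) :: l)) => //=; rewrite e.
Qed.

Lemma teq_catl n m l u v :
  wf_from n l = Some m -> teq m u v -> teq n (l ++ u) (l ++ v).
Proof.
elim: l n => [|[g p] l IH] n /=; first by move=> [->].
by case: ifP => // _ hl e; apply: teq_cons; apply: IH.
Qed.

Lemma teq_X n s p u v : teq n u v -> teq n ((X s, p) :: u) ((X s, p) :: v).
Proof.
elim=> {u v} [w|u v _|u v w _ e1 _ e2|l u v r m e]; first exact: teq_refl.
- exact: teq_sym.
- exact: teq_trans e1 e2.
- apply: (@teq_move _ ((X s, p) :: l)) => //=; rewrite ginX goutX addn2.
  by case: ifP => // h; rewrite subnK ?e // (leq_trans _ h).
Qed.

Lemma teq_Cup n p u v : teq n.+2 u v -> teq n ((Cup, p) :: u) ((Cup, p) :: v).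
Proof. by move=> e; apply: teq_cons; rewrite /= subn0 addn2. Qed.

Lemma teq_Cap n p u v : teq n u v -> teq n.+2 ((Cap, p) :: u) ((Cap, p) :: v).
Proof. by move=> e; apply: teq_cons; rewrite /= addn0 subSS subn1. Qed.

Lemma teq_tail n u v w : lmove u v -> wf_from n u = wf_from n v ->
  teq n (u ++ w) (v ++ w).
Proof. by move=> m e; apply: (@teq_move _ [::]) => //=; rewrite !wf_cat e. Qed.

(** * Elementary moves with an arbitrary continuation *)

Lemma far n g p h q w : p + gout g <= q ->
  teq n ((g, p) :: (h, q) :: w) ((h, q - gout g + gin g) :: (g, p) :: w).
Proof.
move=> le_pq.
apply: (@teq_tail n [:: (g, p); (h, q)] [:: (h, _); (g, p)]).
  exact: lm_far.
move=> /=; move: (gin g) (gout g) (gin h) (gout h) le_pq => a b c d le_pq.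
by do ![case: ifP]; move=> *; first [done | congr Some; lia | lia].
Qed.

Lemma farXX n s i t j w : i.+2 <= j ->
  teq n ((X s, i) :: (X t, j) :: w) ((X t, j) :: (X s, i) :: w).
Proof.
move=> h; have := @far n (X s) i (X t) j w.
by rewrite ginX goutX addn2 subnK ?(leq_trans _ h) //; apply.
Qed.

Lemma farX_Cup n s i j w : i.+2 <= j ->
  teq n ((X s, i) :: (Cup, j) :: w) ((Cup, j) :: (X s, i) :: w).
Proof.
move=> h; have := @far n (X s) i Cup j w.
by rewrite ginX goutX addn2 subnK ?(leq_trans _ h) //; apply.
Qed.

Lemma farX_Cap n s i j w : i.+2 <= j ->
  teq n ((X s, i) :: (Cap, j) :: w) ((Cap, j) :: (X s, i) :: w).
Proof.
move=> h; have := @far n (X s) i Cap j w.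
by rewrite ginX goutX addn2 subnK ?(leq_trans _ h) //; apply.
Qed.

Lemma farCup n i h j w : i <= j ->
  teq n ((Cup, i) :: (h, j.+2) :: w) ((h, j) :: (Cup, i) :: w).
Proof.
move=> le_ij; have := @far n Cup i h j.+2 w.
by rewrite addn2 addn0 !subSS subn0; apply.
Qed.

Lemma farCap n i h j w : i <= j ->
  teq n ((Cap, i) :: (h, j) :: w) ((h, j.+2) :: (Cap, i) :: w).
Proof.
move=> le_ij; have := @far n Cap i h j w.
by rewrite addn0 subn0 addn2; apply.
Qed.

Lemma zig1 n i w : i < n -> teq n ((Cup, i) :: (Cap, i.+1) :: w) w.
Proof.
move=> h; apply: (@teq_tail n [:: _; _] [::]); first exact: lm_zig1.
rewrite wf_Cup; last exact: ltnW.
by case: n h => // n h; rewrite wf_Cap.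
Qed.

Lemma zig2 n i w : i < n -> teq n ((Cup, i.+1) :: (Cap, i) :: w) w.
Proof.
move=> h; apply: (@teq_tail n [:: _; _] [::]); first exact: lm_zig2.
by rewrite wf_Cup // wf_Cap // ltnW.
Qed.

Lemma r2 n s i w : i.+2 <= n -> teq n ((X s, i) :: (X (~~ s), i) :: w) w.
Proof.
move=> h; apply: (@teq_tail n [:: _; _] [::]).
  by case: s; [apply: lm_r2a | apply: lm_r2b].
by rewrite !wf_X.
Qed.

Lemma r2' n s i w : i.+2 <= n -> teq n ((X (~~ s), i) :: (X s, i) :: w) w.
Proof. by move=> h; have := @r2 n (~~ s) i w h; rewrite negbK. Qed.

Ltac wf_move := rewrite /= ?ginX ?goutX; do ![case: ifP => //]; move=> *;
  first [done | congr Some; lia | lia].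

Lemma r3 n s i w : teq n ((X s, i) :: (X s, i.+1) :: (X s, i) :: w)
                         ((X s, i.+1) :: (X s, i) :: (X s, i.+1) :: w).
Proof.
apply: (@teq_tail n [:: _; _; _] [:: _; _; _]).
  by case: s; [apply: lm_r3p | apply: lm_r3n].
wf_move.
Qed.

Lemma r1cup n s i w : teq n ((Cup, i) :: (X s, i) :: w) ((Cup, i) :: w).
Proof.
apply: (@teq_tail n [:: _; _] [:: _]); first exact/lm_r1cup/XP.
wf_move.
Qed.

Lemma r1cap n s i w : teq n ((X s, i) :: (Cap, i) :: w) ((Cap, i) :: w).
Proof.
apply: (@teq_tail n [:: _; _] [:: _]); first exact/lm_r1cap/XP.
wf_move.
Qed.

Lemma cupL n s i w :
  teq n ((Cup, i) :: (X s, i.+1) :: (X s, i) :: w) ((Cup, i.+1) :: w).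
Proof.
apply: (@teq_tail n [:: _; _; _] [:: _]); first exact/lm_cupL/XP.
wf_move.
Qed.

Lemma cupR n s i w : i < n ->
  teq n ((Cup, i.+1) :: (X s, i) :: (X s, i.+1) :: w) ((Cup, i) :: w).
Proof.
move=> h; apply: (@teq_tail n [:: _; _; _] [:: _]); first exact/lm_cupR/XP.
wf_move.
Qed.

Lemma capR n s i w :
  teq n ((X s, i) :: (X s, i.+1) :: (Cap, i) :: w) ((Cap, i.+1) :: w).
Proof.
apply: (@teq_tail n [:: _; _; _] [:: _]); first exact/lm_capR/XP.
wf_move.
Qed.

Lemma capL n s i w : i.+2 < n ->
  teq n ((X s, i.+1) :: (X s, i) :: (Cap, i.+1) :: w) ((Cap, i) :: w).
Proof.
move=> h; apply: (@teq_tail n [:: _; _; _] [:: _]); first exact/lm_capL/XP.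
wf_move.
Qed.

(** * Commuting blocks of slices *)

Definition isX (g : slice) : bool := (gin g.1 == 2) && (gout g.1 == 2).
Definition lowX (q : nat) : pred (seq slice) := all (fun g => isX g && (g.2 + 2 <= q)).
Definition high (q : nat) : pred (seq slice) := all (fun g => q <= g.2).
Definition sh (k : nat) (w : seq slice) : seq slice := [seq (g.1, k + g.2) | g <- w].

Lemma isXX s p : isX (X s, p). Proof. by rewrite /isX ginX goutX. Qed.
Hint Resolve isXX : core.

Lemma isXE g : isX g -> exists s, g = (X s, g.2).
Proof. by case: g => [[] p] //; [exists true | exists false]. Qed.

Lemma lowX_isX q u : lowX q u -> all isX u.
Proof. by apply: sub_all => g /andP[]. Qed.

Lemma teq_Xs n w u v : all isX w -> teq n u v -> teq n (w ++ u) (w ++ v).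
Proof.
elim: w => [|g w IH] //= /andP[/isXE[s ->] hw] e.
exact/teq_X/IH.
Qed.

Lemma teq_nseq n m s p u v :
  teq n u v -> teq n (nseq m (X s, p) ++ u) (nseq m (X s, p) ++ v).
Proof. by apply: teq_Xs; rewrite all_nseq isXX orbT. Qed.

Lemma comm n q u w v : lowX q u -> high q w ->
  teq n (u ++ w ++ v) (w ++ u ++ v).
Proof.
elim: u => [|g u IH] //= /andP[/andP[/isXE[s ->] /=]].
rewrite addn2; move: g.2 => i hi hu hw.
apply: teq_trans (teq_X _ _ (IH hu hw)) _; move: (u ++ v) => {IH hu u}v.
elim: w n hw => [|[h j] w IHw] n //= /andP[hj hw].
apply: teq_trans (teq_cons _ (IHw _ hw)).
have := @far n (X s) i h j (w ++ v).
by rewrite ginX goutX addn2 subnK; [apply; apply: leq_trans hj | lia].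
Qed.

Lemma cup_sh n p w v : high p w ->
  teq n ((Cup, p) :: sh 2 w ++ v) (w ++ (Cup, p) :: v).
Proof.
elim: w n => [|[h j] w IH] n //= /andP[hj hw].
exact: teq_trans (farCup _ _ _ hj) (teq_cons _ (IH _ hw)).
Qed.

Lemma cap_sh n p w v : high p w ->
  teq n ((Cap, p) :: w ++ v) (sh 2 w ++ (Cap, p) :: v).
Proof.
elim: w n => [|[h j] w IH] n //= /andP[hj hw].
exact: teq_trans (farCap _ _ _ hj) (teq_cons _ (IH _ hw)).
Qed.

Lemma nseqC n m s i (h : gen) j w : i.+2 <= j ->
  teq n (nseq m (X s, i) ++ (h, j) :: w) ((h, j) :: nseq m (X s, i) ++ w).
Proof.
move=> hij; apply: (@comm _ j _ [:: (h, j)]); last by rewrite /= leqnn.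
by rewrite /lowX all_nseq isXX /= addn2 hij orbT.
Qed.

Lemma Xnseq n m s i t j w : i.+2 <= j ->
  teq n ((X t, i) :: nseq m (X s, j) ++ w) (nseq m (X s, j) ++ (X t, i) :: w).
Proof.
move=> hij; apply: (@comm _ j [:: (X t, i)]).
  by rewrite /= isXX /= addn2 hij.
by rewrite /high all_nseq leqnn orbT.
Qed.

Lemma Cup_nseq n m s i j w : i <= j ->
  teq n ((Cup, i) :: nseq m (X s, j.+2) ++ w) (nseq m (X s, j) ++ (Cup, i) :: w).
Proof.
move=> hij; have := @cup_sh n i (nseq m (X s, j)) w.
by rewrite /sh map_nseq; apply; rewrite /high all_nseq hij orbT.
Qed.

Lemma Cap_nseq n m s i j w : i <= j ->
  teq n ((Cap, i) :: nseq m (X s, j) ++ w) (nseq m (X s, j.+2) ++ (Cap, i) :: w).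
Proof.
move=> hij; have := @cap_sh n i (nseq m (X s, j)) w.
by rewrite /sh map_nseq; apply; rewrite /high all_nseq hij orbT.
Qed.

(** In [step k lem] the first [k] items of the word are kept and [lem] rewrites what follows; a
    whole [nseq] block counts as one item. [back] uses [lem] from right to left. *)
Ltac peel := first
  [apply: teq_X | apply: teq_Cup | apply: teq_Cap | apply: teq_nseq].
Ltac side := first [done | lia].
Tactic Notation "step" integer(k) uconstr(lem) :=
  eapply teq_trans; [do k peel; eapply lem; side |].
Tactic Notation "back" integer(k) uconstr(lem) :=
  eapply teq_trans; [do k peel; eapply teq_sym, lem; side |].

(** * Derived local moves and rotated twist columns *)

(** The two crossings of type [s] lie on one strand, entirely above or entirely below the other two,
    so the type [t] of the crossing it passes is arbitrary. For [t = ~~ s] an inserted cancelling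
    pair reduces the claim to [r3]. *)
Lemma r3m n s t i w : i.+2 < n ->
  teq n ((X s, i.+1) :: (X s, i) :: (X t, i.+1) :: w)
        ((X t, i) :: (X s, i.+1) :: (X s, i) :: w).
Proof.
move=> hi; have [->|/negPf nst] := eqVneq t s; first exact/teq_sym/r3.
have ->: t = ~~ s by case: t s nst => [] [].
back 0 (r2' s (i := i)).
step 1 r3.
step 3 r2.
done.
Qed.

Lemma r3m' n s t i w : i.+2 < n ->
  teq n ((X s, i) :: (X s, i.+1) :: (X t, i) :: w)
        ((X t, i.+1) :: (X s, i) :: (X s, i.+1) :: w).
Proof.
move=> hi; have [->|/negPf nst] := eqVneq t s; first exact: r3.
have ->: t = ~~ s by case: t s nst => [] [].
back 0 (r2' s (i := i.+1)).
back 1 r3.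
step 3 r2.
done.
Qed.

Lemma r3m'_nseq n s t i m w : i.+2 < n ->
  teq n ((X s, i) :: (X s, i.+1) :: nseq m (X t, i) ++ w)
        (nseq m (X t, i.+1) ++ (X s, i) :: (X s, i.+1) :: w).
Proof.
move=> hi; elim: m => //= m IH.
step 0 r3m'.
exact: teq_X.
Qed.

Lemma cupX n s i w : i < n ->
  teq n ((Cup, i) :: (X s, i.+1) :: w) ((Cup, i.+1) :: (X (~~ s), i) :: w).
Proof. by move=> hi; back 2 (r2 s (i := i)); step 0 cupL. Qed.

Lemma cupX' n s i w : i < n ->
  teq n ((Cup, i.+1) :: (X s, i) :: w) ((Cup, i) :: (X (~~ s), i.+1) :: w).
Proof. by move=> hi; back 2 (r2 s (i := i.+1)); step 0 cupR. Qed.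

Lemma capX n s i w : i.+2 < n ->
  teq n ((X s, i.+1) :: (Cap, i) :: w) ((X (~~ s), i) :: (Cap, i.+1) :: w).
Proof. by move=> hi; back 0 (r2' s (i := i)); step 1 capR. Qed.

Lemma capX' n s i w : i.+2 < n ->
  teq n ((X s, i) :: (Cap, i.+1) :: w) ((X (~~ s), i.+1) :: (Cap, i) :: w).
Proof. by move=> hi; back 0 (r2' s (i := i.+1)); step 1 capL. Qed.

(* A twist column turned by a quarter turn: this is what the pieces of the     *)
(* braid become once their return arcs are pulled in.                         *)
Definition H (s : bool) (p m : nat) : seq slice :=
  (Cup, p.+2) :: nseq m (X s, p.+1) ++ [:: (Cap, p)].
Arguments H : simpl never.

Lemma H1 n s p w : p.+2 <= n -> teq n (H s p 1 ++ w) ((X (~~ s), p) :: w).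
Proof.
move=> hp; rewrite /H /=.
step 1 capX.
back 0 farX_Cup.
step 1 zig2.
done.
Qed.

(** Of the three crossings around the inner twist, one ends up as a kink on a cup and disappears;
    the other two, turned around cups and caps, extend the twist. *)
Lemma traceR n s p m w : p.+2 <= n ->
  teq n ((Cup, p.+2) :: (X (~~ s), p.+1) :: (X s, p) :: H s p.+1 m
          ++ (X (~~ s), p) :: (Cap, p.+2) :: w)
        (H s p m.+2 ++ w).
Proof.
move=> hp; rewrite /H /= -!catA /=.
step 6 farX_Cap.
step 5 farCap.
step 4 nseqC.
step 3 zig1.
step 2 Xnseq.
step 3 capX'.
step 4 farCap.
back 2 r3m'_nseq.
step 0 cupX'.
rewrite negbK.
back 1 r3m'.
step 0 r1cup.
step 0 cupX.
by rewrite negbK.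
Qed.

(** Nested cups form a band of two parallel arcs, and a half twist of the band slides from one end
    to the other. *)
Lemma cup_nested n s i w : i <= n ->
  teq n ((Cup, i) :: (Cup, i.+1) :: (X s, i.+2) :: w)
        ((Cup, i) :: (Cup, i.+1) :: (X s, i) :: w).
Proof.
move=> hi.
step 1 cupX.
step 0 farCup.
back 1 cupX'.
done.
Qed.

(** The counterpart of [traceR] for a return arc on the left. The two new crossings arise at the
    right ends of a pair of nested cups and slide around them to join the [m] others. *)
Lemma traceL n s m w : 2 <= n ->
  teq n ((Cup, 0) :: (X (~~ s), 1) :: H s 1 m
          ++ (X (~~ s), 2) :: (X s, 1) :: (Cap, 0) :: w)
        (H s 0 m.+2 ++ w).
Proof.
move=> hn; rewrite /H /= -!catA /=.
step 0 cupX.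
rewrite negbK.
step 6 capX.
back 5 farXX.
step 1 farX_Cup.
step 2 Xnseq.
step 3 capX'.
step 4 farCap.
step 5 farCap.
step 6 farCap.
back 2 r3m'_nseq.
step 5 capX.
rewrite negbK.
back 1 farX_Cup.
step 0 r1cup.
step 3 nseqC.
step 1 cupX'.
rewrite negbK.
step 0 cup_nested.
step 2 farXX.
step 0 cup_nested.
step 4 nseqC.
step 3 farX_Cap.
step 2 farX_Cap.
step 1 farCup.
step 0 zig1.
done.
Qed.

(** * Runs: one strand crossing several others *)

Lemma wf_add n w m k : wf_from n w = Some m -> wf_from (n + k) w = Some (m + k).
Proof.
elim: w n => [|[g p] w IH] n /=; first by move=> [->].
case: ifP => // hp /IH; rewrite (leq_trans hp (leq_addr _ _)) => <-.
by congr wf_from; lia.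
Qed.

Lemma wf_sh n w m k :
  wf_from n w = Some m -> wf_from (k + n) (sh k w) = Some (k + m).
Proof.
elim: w n => [|[g p] w IH] n /=; first by move=> [->].
case: ifP => // hp /IH; rewrite -addnA leq_add2l hp => <-.
by congr wf_from; lia.
Qed.

Definition runU (s : bool) (p k : nat) : seq slice := [seq (X s, i) | i <- iota p k].
Definition runD (s : bool) (p k : nat) : seq slice :=
  [seq (X s, i) | i <- rev (iota p k)].
Arguments runU : simpl never.
Arguments runD : simpl never.

Lemma runU_cons s p k : runU s p k.+1 = (X s, p) :: runU s p.+1 k.
Proof. by []. Qed.

Lemma runD_add s p j k : runD s p (j + k) = runD s (p + j) k ++ runD s p j.
Proof. by rewrite /runD iotaD rev_cat map_cat. Qed.

Lemma runD_rcons s p k : runD s p k.+1 = runD s p.+1 k ++ [:: (X s, p)].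
Proof. by rewrite -add1n runD_add addn1. Qed.

Lemma runD_cons s p k : runD s p k.+1 = (X s, p + k) :: runD s p k.
Proof. by rewrite -addn1 runD_add. Qed.

Lemma isX_runU s p k : all isX (runU s p k).
Proof. by rewrite /runU all_map; apply/allP => i _ /=. Qed.

Lemma isX_runD s p k : all isX (runD s p k).
Proof. by rewrite /runD all_map; apply/allP => i _ /=. Qed.

Lemma low_runU q s p k : p + k < q -> lowX q (runU s p k).
Proof.
move=> h; rewrite /lowX /runU all_map; apply/allP => i /=.
by rewrite mem_iota isXX; lia.
Qed.

Lemma low_runD q s p k : p + k < q -> lowX q (runD s p k).
Proof.
move=> h; rewrite /lowX /runD all_map; apply/allP => i /=.
by rewrite mem_rev mem_iota isXX; lia.
Qed.

Lemma high_runU q s p k : q <= p -> high q (runU s p k).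
Proof.
by move=> h; rewrite /high /runU all_map; apply/allP => i /=; rewrite mem_iota; lia.
Qed.

Lemma high_runD q s p k : q <= p -> high q (runD s p k).
Proof.
move=> h; rewrite /high /runD all_map; apply/allP => i /=.
by rewrite mem_rev mem_iota; lia.
Qed.

Lemma runUD n s p k w : p + k < n -> teq n (runU s p k ++ runD (~~ s) p k ++ w) w.
Proof.
elim: k p w => // k IH p w h; rewrite runD_rcons runU_cons -catA.
apply: teq_trans (teq_X _ _ (IH _ _ _)) _; first by lia.
by apply: r2; lia.
Qed.

Lemma runDU n s p k w : p + k < n -> teq n (runD s p k ++ runU (~~ s) p k ++ w) w.
Proof.
elim: k p w => // k IH p w h; rewrite runD_rcons runU_cons -catA /=.
apply: teq_trans (teq_Xs (isX_runD _ _ _) (r2 _ _ _)) _; first by lia.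
by apply: IH; lia.
Qed.

(** * Moving a strand across a tangle *)

(** Induction on the number of strands to the right of the slice. If there are none, the moving
    strand meets the slice at once and a cup move, a cap move or [r3m] applies; otherwise its first
    crossing is far from the slice. *)
Lemma slide1 n s k g p w : p + gin g <= k -> k < n ->
  teq n (runD s 0 k ++ (g, p.+1) :: w)
        ((g, p) :: runD s 0 (k - gin g + gout g) ++ w).
Proof.
move=> le_pk; rewrite -(subnK le_pk); move: (k - _) => d {k le_pk}.
elim: d w => [|d IH] w hn.
  have base m : m <= p -> teq n (runD s 0 m ++ (g, p.+1) :: w)
                                ((g, p.+1) :: runD s 0 m ++ w).
    move=> hm; apply: (@comm _ p.+1 _ [:: _]); last by rewrite /= leqnn.
    by apply: low_runD; lia.
  rewrite add0n addnK in hn *.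
  have: (g = Cup) \/ (g = Cap) \/ exists t, g = X t.
    by case: (g); [left | right; left | right; right; exists true
      | right; right; exists false].
  case=> [e|[e|[t e]]]; move: hn base; rewrite e ?ginX ?goutX /= => hn base.
  - rewrite addn0 addn2 !runD_cons /=; apply: teq_trans (base _ (leqnn _)) _.
    by back 0 cupL.
  - rewrite addn0 addn2 !runD_cons /=.
    by step 2 base; step 0 capL.
  - rewrite addn2 !runD_cons /=.
    by step 2 base; step 0 r3m.
rewrite addSn runD_cons add0n /=.
apply: teq_trans (teq_X _ _ (IH _ _)) _; first by lia.
have -> : (d + (p + gin g)).+1 - gin g + gout g = (d + p + gout g).+1 by lia.
have -> : d + (p + gin g) - gin g + gout g = d + p + gout g by lia.
rewrite runD_cons add0n.
have := @far n g p (X s) (d + p + gout g) (runD s 0 (d + p + gout g) ++ w).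
by rewrite addnK addnA => h; apply/teq_sym/h; lia.
Qed.

(* A strand passing over (or under) a whole tangle. *)
Lemma slide n s k w k' v : k < n -> wf_from k w = Some k' ->
  teq n (runD s 0 k ++ sh 1 w ++ v) (w ++ runD s 0 k' ++ v).
Proof.
elim: w n k => [|[g p] w IH] n k hk /=; first by move=> [->].
case: ifP => // hp /IH{}IH.
apply: teq_trans (slide1 _ _ hp hk) _.
by apply/teq_cons/IH; lia.
Qed.

Lemma swing w v : wf_from 1 w = Some 1 ->
  teq 0 ((Cup, 0) :: w ++ (Cap, 0) :: v) ((Cup, 0) :: sh 1 w ++ (Cap, 0) :: v).
Proof.
(* A kink added to the cup is a run of length one. [slide] pushes it through [w], and the cap
   absorbs it. *)
move=> hw; apply: teq_sym; back 0 (r1cup _ true); apply: teq_Cup.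
apply: teq_trans (@slide _ true 1 w 1 _ _ hw) _ => //.
by apply: (teq_catl (wf_add 1 hw)); apply: r1cap.
Qed.

Lemma cup_past n k w k' v : wf_from k w = Some k' ->
  teq n ((Cup, k) :: w ++ v) (w ++ (Cup, k') :: v).
Proof.
elim: w n k => [|[g p] w IH] n k /=; first by move=> [->].
case: ifP => // hp /IH{}IH.
apply: teq_trans (teq_cons _ (IH _)).
have := @far n g p Cup (k - gin g + gout g) (w ++ v).
by rewrite addnK subnK; [move=> h; apply/teq_sym/h; lia | lia].
Qed.

(** The arc joining the two ends of [w] from below is laid above [w] by passing its left leg across
    the tangle. *)
Lemma swing_arc w v : wf_from 0 w = Some 2 ->
  teq 0 ((Cup, 0) :: sh 1 w ++ (Cap, 0) :: (Cap, 0) :: v) (w ++ (Cap, 0) :: v).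
Proof.
(* The leg may pass over or under [w]; [s] only fixes a choice. *)
move=> hw; have s := true.
apply: teq_trans (teq_Cup _ (@slide _ s 0 w 2 _ _ hw)) _ => //.
apply: teq_trans (cup_past _ _ hw) _; apply: (teq_catl hw); rewrite !runD_cons /= !add0n.
step 2 r1cap.
step 1 capX.
back 0 farX_Cup.
step 1 zig2.
step 0 r1cap.
done.
Qed.

(** * Nested return arcs and the closing of a coil *)

Definition Cups (p k : nat) : seq slice := [seq (Cup, i) | i <- iota p k].
Definition Caps (p k : nat) : seq slice := [seq (Cap, i) | i <- rev (iota p k)].
Arguments Cups : simpl never.
Arguments Caps : simpl never.

Lemma Cups_cons p k : Cups p k.+1 = (Cup, p) :: Cups p.+1 k.
Proof. by []. Qed.

Lemma Caps_rcons p k : Caps p k.+1 = Caps p.+1 k ++ [:: (Cap, p)].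
Proof. by rewrite /Caps /= rev_cons map_rcons cats1. Qed.

Lemma Cups_add p j k : Cups p (j + k) = Cups p j ++ Cups (p + j) k.
Proof. by rewrite /Cups iotaD map_cat. Qed.

Lemma Caps_add p j k : Caps p (j + k) = Caps (p + j) k ++ Caps p j.
Proof. by rewrite /Caps iotaD rev_cat map_cat. Qed.

Lemma high_Cups q p k : q <= p -> high q (Cups p k).
Proof.
by move=> h; rewrite /high /Cups all_map; apply/allP => i /=; rewrite mem_iota; lia.
Qed.

Lemma high_Caps q p k : q <= p -> high q (Caps p k).
Proof.
move=> h; rewrite /high /Caps all_map; apply/allP => i /=.
by rewrite mem_rev mem_iota; lia.
Qed.

Lemma teq_Cups n p k u v :
  teq (n + k.*2) u v -> teq n (Cups p k ++ u) (Cups p k ++ v).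
Proof.
elim: k n p => [|k IH] n p; first by rewrite addn0.
by rewrite doubleS !addnS => e; apply/teq_Cup/IH; rewrite !addSn.
Qed.

Definition coil (s : bool) (p h : nat) : seq slice :=
  runU (~~ s) p.+1 h ++ runU s p h ++ runD (~~ s) p h.+1.

(** The first letters of the two upward runs and the last letter of the downward run surround a
    smaller coil at [p.+1]. Closing that coil first, by induction, leaves the situation of
    [traceR]. *)
Lemma trace_coil n s p h w : p.+2 <= n ->
  teq n (Cups p.+2 h ++ coil s p h ++ Caps p.+2 h ++ w) (H s p h.*2.+1 ++ w).
Proof.
elim: h n p w => [|h IH] n p w hp; first exact/teq_sym/H1.
rewrite Caps_rcons Cups_cons /coil !runU_cons (runD_rcons _ p) -!catA /=.
apply: teq_trans _ (traceR s h.*2.+1 w hp).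
apply: teq_Cup.
eapply teq_trans; last first.
  by apply: teq_X; apply: teq_X; apply: IH; lia.
eapply teq_trans; last first.
  apply/teq_sym.
  apply: (@comm _ p.+3 [:: (X (~~ s), p.+1); (X s, p)]); last exact: high_Cups.
  by rewrite /= !isXX /=; lia.
apply/teq_Cups/teq_X; rewrite /coil -!catA.
eapply teq_trans; last first.
  apply/teq_sym.
  apply: (@comm _ p.+2 [:: (X s, p)]); last exact: high_runU.
  by rewrite /= !isXX /=; lia.
apply/teq_Xs/teq_X/teq_Xs/teq_Xs; rewrite ?isX_runU ?isX_runD //.
apply: (@comm _ p.+3 [:: (X (~~ s), p)]); last exact: high_Caps.
by rewrite /= !isXX /=; lia.
Qed.

Lemma low_X q s p : p.+2 <= q -> lowX q [:: (X s, p)].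
Proof. by move=> h; rewrite /lowX /= isXX /= addn2 h. Qed.

Lemma nseqs_comm n m s i k t j w : i.+2 <= j ->
  teq n (nseq m (X s, i) ++ nseq k (X t, j) ++ w)
        (nseq k (X t, j) ++ nseq m (X s, i) ++ w).
Proof.
move=> hij; apply: (@comm _ j).
  by rewrite /lowX all_nseq isXX /= addn2 hij orbT.
by rewrite /high all_nseq leqnn orbT.
Qed.

Lemma nseq_rot (T : Type) m (x : T) w : nseq m x ++ x :: w = x :: nseq m x ++ w.
Proof. by elim: m => //= m ->. Qed.

Lemma cup_nested_nseq n m s i w : i <= n ->
  teq n ((Cup, i) :: (Cup, i.+1) :: nseq m (X s, i.+2) ++ w)
        ((Cup, i) :: (Cup, i.+1) :: nseq m (X s, i) ++ w).
Proof.
move=> hi; elim: m w => //= m IH w.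
step 0 cup_nested.
step 2 Xnseq.
by apply: teq_trans (IH _) _; rewrite nseq_rot.
Qed.

(** * Carrying a tangle past a group of strands *)

(** The two stacks of a'c' crossings. In both, [c] strands pass over [a] strands: here the [a]
    strands move left under them one by one, and in [over_out] the [c] strands return to the left
    one by one. *)
Definition over_in (q a c : nat) : seq slice :=
  flatten [seq runD true k c | k <- iota q a].
Definition over_out (q a c : nat) : seq slice :=
  flatten [seq runD false k a | k <- iota q c].
Arguments over_in : simpl never.
Arguments over_out : simpl never.

Lemma over_in_cons q a c : over_in q a.+1 c = runD true q c ++ over_in q.+1 a c.
Proof. by []. Qed.

Lemma over_out_cons q a c : over_out q a c.+1 = runD false q a ++ over_out q.+1 a c.
Proof. by []. Qed.

Lemma over_in0 q a : over_in q a 0 = [::].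
Proof. by elim: a q => // a IH q; rewrite over_in_cons IH. Qed.

Lemma over_out0 q c : over_out q 0 c = [::].
Proof. by elim: c q => // c IH q; rewrite over_out_cons IH. Qed.

Lemma isX_over_in q a c : all isX (over_in q a c).
Proof. by elim: a q => // a IH q; rewrite over_in_cons all_cat isX_runD IH. Qed.

Lemma high_over_in r q a c : r <= q -> high r (over_in q a c).
Proof.
elim: a q => // a IH q h; rewrite over_in_cons /high all_cat.
by apply/andP; split; [apply: high_runD | apply/IH/leqW].
Qed.

Lemma high_over_out r q a c : r <= q -> high r (over_out q a c).
Proof.
elim: c q => // c IH q h; rewrite over_out_cons /high all_cat.
by apply/andP; split; [apply: high_runD | apply/IH/leqW].
Qed.

(** The rectangle of crossings is read with the leftmost of the [c.+1] strands crossing the [a]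
    strands last. *)
Lemma over_in_peel n q a c v :
  teq n (over_in q a c.+1 ++ v) (over_in q.+1 a c ++ runU true q a ++ v).
Proof.
elim: a q v => // a IH q v; rewrite !over_in_cons runD_rcons runU_cons -!catA.
apply: teq_Xs; first exact: isX_runD.
apply: teq_trans (teq_X _ _ (IH _ _)) _.
by apply: (@comm _ q.+2 [:: _]); [apply: low_X | apply: high_over_in].
Qed.

(** The alternative route: the [c] strands pass over the [q] strands on their left and avoid the
    tangle on that side. *)
Definition under_pre (q c : nat) : seq slice :=
  flatten [seq runD false 0 k | k <- iota q c].
Definition under_post (q c : nat) : seq slice :=
  flatten [seq runU true 0 k | k <- rev (iota q c)].

Lemma under_pre_cons q c : under_pre q c.+1 = runD false 0 q ++ under_pre q.+1 c.
Proof. by []. Qed.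

Lemma under_post_rcons q c : under_post q c.+1 = under_post q.+1 c ++ runU true 0 q.
Proof. by rewrite /under_post /= rev_cons map_rcons flatten_rcons. Qed.

Lemma low_under_pre r q c : q + c <= r -> lowX r (under_pre q c).
Proof.
elim: c q => // c IH q h; rewrite under_pre_cons /lowX all_cat.
by apply/andP; split; [apply: low_runD | apply: IH]; lia.
Qed.

Lemma low_under_post r q c : q + c <= r -> lowX r (under_post q c).
Proof.
elim: c q => // c IH q h; rewrite under_post_rcons /lowX all_cat.
by apply/andP; split; [apply: IH | apply: low_runU]; lia.
Qed.

Lemma sh0 w : sh 0 w = w.
Proof. by elim: w => [|[g p] w IH] //=; rewrite IH. Qed.

Lemma sh_sh j k w : sh j (sh k w) = sh (j + k) w.
Proof. by rewrite /sh -map_comp; apply: eq_map => g /=; rewrite addnA. Qed.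

(** A strand lying above everything may pass [A] on its right or on its left. The run to the far
    left and its inverse are inserted after [A], and [slide] then takes the whole leftward run
    across [A]. *)
Lemma carry1 n q a A v : q + a < n -> wf_from (q + a) A = Some (q + a) ->
  teq n (runU true q a ++ A ++ runD false q a ++ v)
        (runD false 0 q ++ sh 1 A ++ runU true 0 q ++ v).
Proof.
move=> hn hA.
have hA' := wf_add (n - (q + a)) hA; rewrite subnKC ?(ltnW hn) // in hA'.
have hU : all isX (runU true q a) by apply: isX_runU.
apply: teq_trans (teq_Xs hU _) _.
  apply/(teq_catl hA')/teq_Xs; first exact: isX_runD.
  by apply/teq_sym; apply: (@runDU n false 0 q); lia.
rewrite (catA (runD _ q a)) -{2}(add0n q) -runD_add.
apply: teq_trans (teq_Xs hU (teq_sym (slide _ _ hn hA))) _.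
rewrite runD_add add0n -catA; apply: runUD; lia.
Qed.

Lemma carry n q a c A v : q + a + c <= n -> wf_from (q + a) A = Some (q + a) ->
  teq n (over_in q a c ++ A ++ over_out q a c ++ v)
        (under_pre q c ++ sh c A ++ under_post q c ++ v).
Proof.
elim: c q A v => [|c IH] q A v hn hA; first by rewrite over_in0 sh0.
rewrite over_out_cons under_pre_cons under_post_rcons -!catA.
apply: teq_trans (over_in_peel _ _ _ _ _) _.
apply: teq_trans (teq_Xs (isX_over_in _ _ _) (carry1 _ _ hA)) _; first by lia.
apply: teq_trans (teq_sym (@comm _ q.+1 _ _ _ _ _)) _.
- by apply: low_runD; lia.
- exact: high_over_in.
apply: teq_Xs; first exact: isX_runD.
have {}hA : wf_from (q.+1 + a) (sh 1 A) = Some (q.+1 + a) := wf_sh 1 hA.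
have e : sh c.+1 A = sh c (sh 1 A) by rewrite sh_sh addn1.
rewrite e; apply: teq_trans (IH _ _ _ _ hA); last by lia.
apply: teq_Xs; first exact: isX_over_in.
have := wf_add (n - (q.+1 + a)) hA; rewrite subnKC; last by lia.
move=> hA'; apply: (teq_catl hA').
apply: (@comm _ q.+1); last exact: high_over_out.
by apply: low_runU; lia.
Qed.

(** * Shifts and strand counts of the composite pieces *)

Lemma sh_runU s p k c : sh c (runU s p k) = runU s (c + p) k.
Proof. by rewrite /sh /runU -map_comp iotaDl -map_comp. Qed.

Lemma sh_runD s p k c : sh c (runD s p k) = runD s (c + p) k.
Proof. by rewrite /sh /runD -map_comp iotaDl -map_rev -map_comp. Qed.

Lemma sh_Cups p k c : sh c (Cups p k) = Cups (c + p) k.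
Proof. by rewrite /sh /Cups -map_comp iotaDl -map_comp. Qed.

Lemma sh_Caps p k c : sh c (Caps p k) = Caps (c + p) k.
Proof. by rewrite /sh /Caps -map_comp iotaDl -map_rev -map_comp. Qed.

Lemma sh_H s p m c : sh c (H s p m) = H s (c + p) m.
Proof. by rewrite /H /sh /= map_cat map_nseq /= !addnS. Qed.

Lemma sh_cat c u v : sh c (u ++ v) = sh c u ++ sh c v.
Proof. exact: map_cat. Qed.

Lemma sh_coil s p h c : sh c (coil s p h) = coil s (c + p) h.
Proof. by rewrite /coil !sh_cat !sh_runU sh_runD addnS. Qed.

Lemma wf_Xs n u w : lowX n u -> wf_from n (u ++ w) = wf_from n w.
Proof.
elim: u => //= g u IH /andP[/andP[/isXE[s ->] /=]]; rewrite addn2 => h /IH <-.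
exact: wf_X.
Qed.

Lemma wf_nseq n m s i w : i.+2 <= n ->
  wf_from n (nseq m (X s, i) ++ w) = wf_from n w.
Proof. by move=> h; apply: wf_Xs; rewrite /lowX all_nseq isXX /= addn2 h orbT. Qed.

Lemma wf_Hcat n s p m w : p.+2 <= n -> wf_from n (H s p m ++ w) = wf_from n w.
Proof.
move=> h; rewrite /H /= -catA addn0 h addn2 subn0 wf_nseq /=; last by lia.
by rewrite addn0 subn2 /= ifT //; lia.
Qed.

Lemma wf_H n s p m : p.+2 <= n -> wf_from n (H s p m) = Some n.
Proof. by move=> h; rewrite -[H _ _ _]cats0 wf_Hcat. Qed.

Lemma wf_Cups n p k w : p <= n ->
  wf_from n (Cups p k ++ w) = wf_from (n + k.*2) w.
Proof.
elim: k n p => [|k IH] n p h; first by rewrite addn0.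
rewrite Cups_cons cat_cons wf_Cup // IH; last by lia.
by congr wf_from; lia.
Qed.

Lemma wf_Caps n p k w : p <= n ->
  wf_from (n + k.*2) (Caps p k ++ w) = wf_from n w.
Proof.
elim: k n p w => [|k IH] n p w h; first by rewrite addn0.
rewrite Caps_rcons -catA /=.
have -> : n + k.+1.*2 = n.+2 + k.*2 by lia.
by rewrite IH ?wf_Cap //; lia.
Qed.

Lemma wf_coil n s p h w : p.+2 + h <= n ->
  wf_from n (coil s p h ++ w) = wf_from n w.
Proof.
move=> hn; rewrite /coil -!catA !wf_Xs //.
- by apply: low_runD; lia.
- by apply: low_runU; lia.
- by apply: low_runU; lia.
Qed.

(** * Removing the coils and the spiral *)

(** After [carry] the coil lies to the right of the [c] strands, next to its own return arcs, so
    [trace_coil] applies there. *)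
Lemma trace_carried n s p a c v : p.+2 + c <= n ->
  teq n (Cups (p.+2 + c) a ++ over_in p.+2 a c ++ coil s p a
           ++ over_out p.+2 a c ++ Caps (p.+2 + c) a ++ v)
        (H s p a.*2.+1 ++ v).
Proof.
move=> hn.
have hA : wf_from (p.+2 + a) (coil s p a) = Some (p.+2 + a).
  by rewrite -[coil _ _ _]cats0 wf_coil.
have hH : wf_from (p.+2 + 0) (H s p a.*2.+1) = Some (p.+2 + 0).
  by apply: wf_H; lia.
have hlow : all isX (under_pre p.+2 c).
  exact: lowX_isX (low_under_pre (leqnn _)).
apply: teq_trans (teq_Cups _ (carry _ _ hA)) _; first by lia.
apply: teq_trans (teq_sym (@comm _ (p.+2 + c) _ _ _ _ _)) _.
- exact: low_under_pre.
- exact: high_Cups.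
(* With [a = 0] both stacks are empty, so [carry] read backwards brings the unrolled twist from
   [p + c] back to [p]. *)
have := @carry n _ 0 c _ v _ hH.
rewrite over_out0 (_ : over_in _ 0 c = [::]) // !cat0s => /(_ _)/teq_sym e.
apply: teq_trans _ (e _); last by lia.
rewrite sh_coil sh_H; apply: (teq_Xs hlow).
apply: teq_trans _ (trace_coil _ _ _ _); last by lia.
rewrite (addnC c); apply: teq_Cups.
have hc : wf_from (n + a.*2) (coil s (p + c) a) = Some (n + a.*2).
  by rewrite -[coil _ _ _]cats0 wf_coil //; lia.
apply: (teq_catl hc).
apply: (@comm _ (p.+2 + c)); last exact: high_Caps.
exact: low_under_post.
Qed.

Lemma Cups_past n k C w v : wf_from k w = Some k ->
  teq n (Cups k C ++ w ++ v) (w ++ Cups k C ++ v).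
Proof.
elim: C n v => // C IH n v hw; rewrite -addn1 Cups_add -!catA.
rewrite /=.
apply: teq_trans (teq_Cups _ (cup_past _ _ (wf_add C hw))) _.
exact: IH.
Qed.

Lemma high0 w : high 0 w. Proof. by elim: w. Qed.

Lemma wf_catE n m u v : wf_from n u = Some m -> wf_from n (u ++ v) = wf_from m v.
Proof. by rewrite wf_cat => ->. Qed.

(* Each turn of the spiral is undone by swinging its outermost return arc     *)
(* around to the left, where it becomes the arc removed by [traceL].          *)
Lemma unspool s t r j m k h :
  teq 0 (Cups 0 h.+2 ++ H s h j ++ runD (~~ t) 0 h ++ H t 0 m
           ++ runU (~~ t) 1 h ++ runU t 0 h ++ H r h k ++ Caps 0 h.+2)
        (Cups 0 2 ++ H s 0 j ++ H t 0 (m + h.*2) ++ H r 0 k ++ Caps 0 2).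
Proof.
elim: h m => [|h IH] m; first by rewrite addn0.
have -> : m + h.+1.*2 = m.+2 + h.*2 by lia.
apply: teq_trans (IH _).
(* [w] and [u] are the parts below and above the core in the diagram with one turn fewer. The
   present diagram contains them shifted by one, around [mid]. *)
have [w wE] : exists w, w = Cups 0 h.+2 ++ H s h j ++ runD (~~ t) 0 h by eexists.
have [u uE] : exists u, u = runU (~~ t) 1 h ++ runU t 0 h ++ H r h k ++ Caps 0 h.+2.
  by eexists.
have hw1 : sh 1 w = Cups 1 h.+2 ++ H s h.+1 j ++ runD (~~ t) 1 h.
  by rewrite wE !(sh_cat, sh_Cups, sh_H, sh_runD).
have hu1 : sh 1 u = runU (~~ t) 2 h ++ runU t 1 h ++ H r h.+1 k ++ Caps 1 h.+2.
  by rewrite uE !(sh_cat, sh_runU, sh_H, sh_Caps).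
have hw : wf_from 0 w = Some h.+2.*2.
  rewrite wE wf_Cups // wf_Hcat; last by lia.
  by rewrite -[runD _ _ _]cats0 wf_Xs //; apply: low_runD; lia.
have hu : wf_from h.+2.*2 u = Some 0.
  rewrite uE 2?wf_Xs; try by apply: low_runU; lia.
  rewrite wf_Hcat; last by lia.
  by rewrite -[Caps _ _]cats0; apply: (@wf_Caps 0 0 h.+2 [::]).
have hH q i : wf_from (q + h.+2.*2) (H i 0 m) = Some (q + h.+2.*2).
  by apply: wf_H; lia.
pose mid := [:: (X (~~ t), 0)] ++ H t 0 m ++ [:: (X (~~ t), 1); (X t, 0)].
have hmid : wf_from (1 + h.+2.*2) mid = Some (1 + h.+2.*2).
  rewrite /mid wf_Xs; last by apply: low_X; lia.
  by rewrite wf_Hcat ?wf_X //; lia.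
apply: teq_trans (_ : teq 0 _ ((Cup, 0) :: (sh 1 w ++ mid ++ sh 1 u) ++ [:: (Cap, 0)])) _.
  rewrite (Caps_rcons 0) Cups_cons runD_rcons !runU_cons hw1 hu1 /mid.
  rewrite -(cat1s (X (~~ t), 1) (runU _ _ _)) -(cat1s (X t, 0) (runU _ _ _)).
  rewrite -!catA; apply: (@teq_Cup 0 0 (Cups 1 h.+2 ++ _)); apply: teq_Cups.
  apply: teq_catl (wf_H _ _ _) _; first by lia.
  apply: teq_Xs; first exact: isX_runD.
  apply: teq_X; apply: teq_catl (hH 2 t) _; apply: teq_X.
  by apply/teq_sym/(@comm _ 2 [:: _]); [apply: low_X | apply: high_runU].
apply: teq_trans (swing _ _) _.
  by rewrite (wf_catE _ (wf_sh 1 hw)) (wf_catE _ hmid) (wf_sh 1 hu).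
rewrite !sh_cat !(sh_sh 1 1) -!catA.
apply: teq_trans (cup_sh _ _ (high0 w)) _.
have -> : forall v, Cups 0 h.+2 ++ H s h j ++ runD (~~ t) 0 h ++ v = w ++ v.
  by move=> v; rewrite wE -!catA.
rewrite -uE; apply: (teq_catl hw); rewrite -[in X in teq _ _ X](cats0 u).
apply: teq_trans _ (@traceL _ t m (u ++ [::]) _); last by lia.
rewrite sh_H; apply/teq_Cup/teq_X/(teq_catl (wf_H _ _ _)) => //.
apply/teq_X/teq_X; rewrite cats0; apply/teq_sym.
by rewrite -[X in teq _ (_ :: X)]cats0; apply/cap_sh/high0.
Qed.

(** * Recognising the pretzel diagram *)

Definition pretzel3 (s t r : bool) (j m k : nat) : seq slice :=
  (Cup, 0) :: (Cup, 1) :: (Cup, 1) ::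
   nseq j (X s, 0) ++ nseq m (X t, 2) ++ nseq k (X r, 4)
   ++ [:: (Cap, 1); (Cap, 1); (Cap, 0)].

Lemma closure2_pretzel s t r j m k :
  teq 0 (Cups 0 2 ++ H s 0 j ++ H t 0 m ++ H r 0 k ++ Caps 0 2)
        (pretzel3 s t r j m k).
Proof.
rewrite /H /Cups /Caps /=; do !rewrite -catA /=.
step 4 farCap.
step 3 nseqC.
step 5 Cap_nseq.
step 7 farCap.
step 6 farCap.
step 5 nseqC.
step 4 nseqC.
step 8 Cap_nseq.
step 7 Cap_nseq.
step 8 farCap.
step 9 farCap.
step 10 farCap.
(* At this point the three columns stand side by side in [w], whose two open ends are joined by an
   arc running below it; [swing_arc] turns this arc into a top one. *)
pose w := (Cup, 0) :: (Cup, 1) :: (Cup, 3) :: (Cup, 5) ::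
  nseq j (X s, 0) ++ nseq m (X t, 2) ++ nseq k (X r, 4)
  ++ [:: (Cap, 1); (Cap, 1); (Cap, 2)].
have hw : wf_from 0 w = Some 2 by rewrite /= !wf_nseq.
have := swing_arc [::] hw; rewrite /sh /= !map_cat !map_nseq -!catA => e.
apply: teq_trans e _.
step 8 farCap.
step 7 farCap.
step 6 nseqC.
step 5 nseqC.
step 4 nseqC.
step 3 zig1.
step 1 farCup.
done.
Qed.

Lemma coil_even_pretzel s t r j m k :
  teq 0 (Cups 0 3 ++ nseq k (X r, 0) ++ (X (~~ t), 1) :: nseq j (X s, 0)
           ++ H t 1 m ++ Caps 0 3)
        (pretzel3 s t r j m.+1 k).
Proof.
rewrite /H /Cups /Caps /=; do !rewrite -catA /=.
step 8 farCap.
step 7 nseqC.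
step 6 zig1.
back 2 nseqC.
(* Turned around the cup, the lone crossing changes type and becomes the additional crossing of the
   middle column. *)
step 3 cupX'.
rewrite negbK.
back 4 nseqC.
(* The [r] column slides along the nested bottom arcs from the left end to the right end. *)
back 0 cup_nested_nseq.
back 2 Cup_nseq.
back 3 nseqs_comm.
exact/teq_Cup/teq_Cup/teq_Cup/teq_nseq/teq_sym/(nseqs_comm _ m.+1).
Qed.

(** * Translating braid words into crossing slices *)

Definition enc (g : slice) : int :=
  if g.1 is Xp then Posz g.2.+1 else Negz g.2.

Lemma enc_X s p : enc (X s, p) = if s then Posz p.+1 else Negz p.
Proof. by case: s. Qed.

Lemma closure_enc n w : all isX w ->
  Defs.closure n [seq enc g | g <- w] = Cups 0 n ++ w ++ Caps 0 n.
Proof.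
move=> hw; rewrite /Defs.closure -map_comp; congr (_ ++ (_ ++ _)).
by elim: w hw => [|g w IH] //= /andP[/isXE[s ->] /IH ->]; rewrite enc_X; case: s.
Qed.

Lemma is_braid_enc n w : lowX n w -> is_braid n [seq enc g | g <- w].
Proof.
rewrite /is_braid all_map; apply: sub_all => g /andP[/isXE[s ->]] /=.
by rewrite enc_X; case: s; lia.
Qed.

(** The endpoints are variables constrained by equations, so that expressions in the theorem need to
    match only up to arithmetic. For [k = 0] both sides are empty. *)
Lemma bup_pos (i j : int) p k : i = Posz p.+1 -> j = Posz (p + k) ->
  bup i j = [seq enc g | g <- runU true p k].
Proof.
move=> -> ->; rewrite /bup /runU -map_comp.
case: k => [|k]; first by rewrite ifF //; lia.
rewrite ifT; last by lia.
rewrite (_ : `|_|.+1 = k.+1); last by lia.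
rewrite -[in RHS](addn0 p) iotaDl -map_comp; apply: eq_map => i' /=.
by rewrite /enc /=; lia.
Qed.

Lemma bdown_neg (i j : int) p k : i = Negz p -> j = (- Posz (p + k))%R ->
  bdown i j = [seq enc g | g <- runU false p k].
Proof.
move=> -> ->; rewrite /bdown /runU -map_comp.
case: k => [|k]; first by rewrite ifF //; lia.
rewrite ifT; last by lia.
rewrite (_ : `|_|.+1 = k.+1); last by lia.
rewrite -[in RHS](addn0 p) iotaDl -map_comp; apply: eq_map => i' /=.
by rewrite /enc /=; lia.
Qed.

Lemma rev_iota p k : rev (iota p k) = [seq p + k - i.+1 | i <- iota 0 k].
Proof.
apply: (@eq_from_nth _ 0) => [|i]; rewrite size_rev ?size_map !size_iota // => hi.
by rewrite nth_rev ?size_iota // (nth_map 0) ?size_iota // !nth_iota //; lia.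
Qed.

Lemma bdown_pos (i j : int) p k : i = Posz (p + k) -> j = Posz p.+1 ->
  bdown i j = [seq enc g | g <- runD true p k].
Proof.
move=> -> ->; rewrite /bdown /runD -map_comp rev_iota -map_comp.
case: k => [|k]; first by rewrite ifF //; lia.
rewrite ifT; last by lia.
rewrite (_ : `|_|.+1 = k.+1); last by lia.
by apply/eq_in_map => i'; rewrite mem_iota /enc /=; lia.
Qed.

Lemma bup_neg (i j : int) p k : i = (- Posz (p + k))%R -> j = Negz p ->
  bup i j = [seq enc g | g <- runD false p k].
Proof.
move=> -> ->; rewrite /bup /runD -map_comp rev_iota -map_comp.
case: k => [|k]; first by rewrite ifF //; lia.
rewrite ifT; last by lia.
rewrite (_ : `|_|.+1 = k.+1); last by lia.
by apply/eq_in_map => i'; rewrite mem_iota /enc /=; lia.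
Qed.

Lemma sscale_enc (a : int) s (e : seq nat) :
  sscale a [seq enc g | g <- [seq (X s, i) | i <- e]]
  = [seq enc g | g <- [seq (X (s == (0 < a)%R), i) | i <- e]].
Proof.
rewrite /sscale -!map_comp; apply: eq_map => i /=.
by rewrite !enc_X /sgnz; case: ifP; case: s => /=; lia.
Qed.

Lemma bpow1_enc (e : int) :
  bpow 1 e = [seq enc g | g <- nseq `|e| (X (0 < e)%R, 0)].
Proof.
rewrite /bpow map_nseq; congr nseq.
by rewrite enc_X /sgnz; case: ifP.
Qed.

Lemma shift_up_enc (i j : int) q a c : i = Posz (q + c) -> j = Posz q.+1 ->
  shift_up bdown i j a = [seq enc g | g <- over_in q a c].
Proof.
move=> -> ->; rewrite /shift_up /over_in map_flatten.
rewrite -[in iota q a](addn0 q) iotaDl -!map_comp.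
by congr flatten; apply: eq_map => k /=; apply: bdown_pos; lia.
Qed.

Lemma shift_down_enc (i j : int) q a c : i = (- Posz (q + a))%R -> j = Negz q ->
  shift_down bup i j c = [seq enc g | g <- over_out q a c].
Proof.
move=> -> ->; rewrite /shift_down /over_out map_flatten.
rewrite -[in iota q c](addn0 q) iotaDl -!map_comp.
by congr flatten; apply: eq_map => k /=; apply: bup_neg; lia.
Qed.

Lemma coil_enc (a x1 y1 x2 y2 x3 y3 : int) p h :
  x1 = Negz p.+1 -> y1 = (- Posz (p.+1 + h))%R ->
  x2 = Posz p.+1 -> y2 = Posz (p + h) ->
  x3 = (- Posz (p + h.+1))%R -> y3 = Negz p ->
  sscale a (bdown x1 y1 ++ bup x2 y2 ++ bup x3 y3)
  = [seq enc g | g <- coil (0 < a)%R p h].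
Proof.
move=> e1 e2 e3 e4 e5 e6.
rewrite (bdown_neg e1 e2) (bup_pos e3 e4) (bup_neg e5 e6) /sscale !map_cat.
by rewrite -!/(sscale a _) /runU /runD !sscale_enc; case: (0 < a)%R.
Qed.

Lemma spiral_enc (b x1 y1 x2 y2 x3 y3 : int) h :
  x1 = (- Posz h)%R -> y1 = (-1)%R -> x2 = (-1)%R -> y2 = (- Posz h.+1)%R ->
  x3 = 1%R -> y3 = Posz h ->
  sscale b (bup x1 y1 ++ bdown x2 y2 ++ bup x3 y3)
  = [seq enc g | g <- runD (~~ (0 < b)%R) 0 h ++ runU (~~ (0 < b)%R) 0 h.+1
                      ++ runU (0 < b)%R 0 h].
Proof.
move=> e1 e2 e3 e4 e5 e6.
rewrite (@bup_neg _ _ 0 h e1) // (@bdown_neg _ _ 0 h.+1 _ e4) //.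
rewrite (@bup_pos _ _ 0 h) // /sscale !map_cat.
by rewrite -!/(sscale b _) /runU /runD !sscale_enc; case: (0 < b)%R.
Qed.

Lemma pretzel3E (a b c : int) : pretzel [:: a; b; c] =
  pretzel3 (0 < a)%R (0 < b)%R (0 < c)%R `|a| `|b| `|c|.
Proof. by rewrite /pretzel /pretzel3 /= cats0 -!catA. Qed.

Lemma is_closure_enc (a b c : int) n w : lowX n w ->
  teq 0 (Cups 0 n ++ w ++ Caps 0 n)
    (pretzel3 (0 < a)%R (0 < b)%R (0 < c)%R `|a| `|b| `|c|) ->
  is_closure (pretzel [:: a; b; c]) n [seq enc g | g <- w].
Proof.
move=> hw e; split; first exact: is_braid_enc.
rewrite closure_enc ?(lowX_isX hw) // pretzel3E.
apply: teq_isotopic (teq_sym e) _.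
by rewrite /link_word /= !wf_nseq.
Qed.

Lemma low_cat q u v : lowX q u -> lowX q v -> lowX q (u ++ v).
Proof. by rewrite /lowX all_cat => -> ->. Qed.

Lemma low_over_in r q a c : q + a + c <= r -> lowX r (over_in q a c).
Proof.
elim: a q => // a IH q h; rewrite over_in_cons /lowX all_cat.
by apply/andP; split; [apply: low_runD | apply: IH]; lia.
Qed.

Lemma low_over_out r q a c : q + a + c <= r -> lowX r (over_out q a c).
Proof.
elim: c q => // c IH q h; rewrite over_out_cons /lowX all_cat.
by apply/andP; split; [apply: low_runD | apply: IH]; lia.
Qed.

Lemma low_coil r s p h : p + h.+1 < r -> lowX r (coil s p h).
Proof.
move=> hr; rewrite /coil /lowX !all_cat; apply/and3P.
by split; [apply: low_runU | apply: low_runU | apply: low_runD]; lia.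
Qed.

Lemma low_nseq r m s p : p.+2 <= r -> lowX r (nseq m (X s, p)).
Proof. by move=> h; rewrite /lowX all_nseq isXX /= addn2 h orbT. Qed.

(** * The two families of braids *)

(** Here [a], [b], [c] stand for the halves a', b', c', and the Booleans for the signs of the three
    entries. *)
Definition odd_braid (s t r : bool) (a b c : nat) : seq slice :=
  over_in b.+2 a c ++ coil s b a ++ over_out b.+2 a c
  ++ runD (~~ t) 0 b ++ runU (~~ t) 0 b.+1 ++ runU t 0 b ++ coil r b c.

Lemma low_odd_braid s t r a b c : lowX (a + b + c).+2 (odd_braid s t r a b c).
Proof.
apply: low_cat; first by apply: low_over_in; lia.
apply: low_cat; first by apply: low_coil; lia.
apply: low_cat; first by apply: low_over_out; lia.
apply: low_cat; first by apply: low_runD; lia.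
apply: low_cat; first by apply: low_runU; lia.
by apply: low_cat; [apply: low_runU | apply: low_coil]; lia.
Qed.

Lemma size_runU s p k : size (runU s p k) = k.
Proof. by rewrite size_map size_iota. Qed.

Lemma size_runD s p k : size (runD s p k) = k.
Proof. by rewrite size_map size_rev size_iota. Qed.

Lemma size_over_in q a c : size (over_in q a c) = a * c.
Proof.
by elim: a q => // a IH q; rewrite over_in_cons size_cat size_runD IH mulSn.
Qed.

Lemma size_over_out q a c : size (over_out q a c) = a * c.
Proof.
elim: c q => [|c IH] q; first by rewrite muln0.
by rewrite over_out_cons size_cat size_runD IH mulnS.
Qed.

Lemma size_odd_braid s t r a b c :
  size (odd_braid s t r a b c) = 2 * (a * c) + 3 * (a + b + c) + 3.
Proof.
rewrite /odd_braid /coil !size_cat !(size_runU, size_runD, size_over_in, size_over_out).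
lia.
Qed.

Lemma odd_braid_pretzel s t r a b c :
  teq 0 (Cups 0 (a + b + c).+2 ++ odd_braid s t r a b c ++ Caps 0 (a + b + c).+2)
    (pretzel3 s t r a.*2.+1 b.*2.+1 c.*2.+1).
Proof.
(* From left to right: the strands of the spiral, those closing the c-coil, those closing the
   a-coil. The last group has the innermost return arcs and is removed first. *)
have -> : (a + b + c).+2 = b.+2 + c + a by lia.
have [mid midE] : exists w, w = runD (~~ t) 0 b ++ runU (~~ t) 0 b.+1 ++ runU t 0 b.
  by eexists.
have -> v : odd_braid s t r a b c ++ v = over_in b.+2 a c ++ coil s b a
    ++ over_out b.+2 a c ++ (mid ++ coil r b c) ++ v.
  by rewrite midE /odd_braid -!catA.
rewrite Cups_add Caps_add (Cups_add 0) (Caps_add 0) !add0n -!(catA (Cups _ _)).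
have hmid : lowX b.+2 mid.
  rewrite midE; apply: low_cat; first by apply: low_runD; lia.
  by apply: low_cat; apply: low_runU; lia.
have hlow : lowX (b.+2 + c) (mid ++ coil r b c).
  apply: low_cat; last by apply: low_coil; lia.
  by apply: sub_all hmid => g /andP[-> /=]; lia.
apply: teq_trans (_ : teq 0 _ (Cups 0 b.+2 ++ Cups b.+2 c ++ H s b a.*2.+1 ++
   (mid ++ coil r b c) ++ Caps b.+2 c ++ Caps 0 b.+2)) _.
  apply/teq_Cups/teq_Cups.
  apply: teq_trans _ (@trace_carried _ _ _ _ c _ _); last by lia.
  apply: teq_Cups; apply: (teq_Xs (isX_over_in _ _ _)).
  apply: teq_Xs; first by apply: (@lowX_isX (b + a.+1).+1); apply: low_coil; lia.
  apply: teq_Xs; first exact: (lowX_isX (low_over_out (leqnn _))).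
  by apply: comm hlow _; apply: high_Caps.
apply: teq_trans (_ : teq 0 _ (Cups 0 b.+2 ++ H s b a.*2.+1 ++ mid ++ H r b c.*2.+1
   ++ Caps 0 b.+2)) _.
  apply: teq_Cups; have hH q : wf_from (b.+2 + q) (H s b a.*2.+1) = Some (b.+2 + q).
    by apply: wf_H; lia.
  (* The twist and the spiral use only the first [b.+2] points, so the cups of the c-coil can be
     created after them. *)
  rewrite -(catA mid); apply: teq_trans (Cups_past _ _ _ (_ : _ = Some b.+2)) _.
    by rewrite -[in LHS](addn0 b.+2) hH addn0.
  have := hH b.+2; rewrite addnn => hH'; apply: (teq_catl hH').
  apply: teq_trans (teq_sym (@comm _ b.+2 _ _ _ hmid _)) _; first exact: high_Cups.
  apply: (teq_Xs (lowX_isX hmid)); apply: trace_coil; lia.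
apply: teq_trans _ (closure2_pretzel _ _ _ _ _ _).
(* The core of the spiral is a twist with one crossing, and each of its [b] turns contributes
   two. *)
have -> : b.*2.+1 = 1 + b.*2 by [].
apply: teq_trans _ (unspool _ _ _ _ _ _ _); apply: teq_Cups.
apply: teq_catl (wf_H _ _ _) _; first by lia.
rewrite midE -!catA; apply: teq_Xs; first exact: isX_runD.
by rewrite runU_cons; apply: teq_sym; apply: H1; lia.
Qed.

Definition even_braid (s t r : bool) (j k h : nat) : seq slice :=
  nseq k (X r, 0) ++ runU (~~ t) 1 h.+1 ++ nseq j (X s, 0)
  ++ runU t 1 h ++ runD (~~ t) 1 h.+1.

Lemma low_even_braid s t r j k h : lowX h.+3 (even_braid s t r j k h).
Proof.
apply: low_cat; first exact: low_nseq.
apply: low_cat; first by apply: low_runU; lia.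
apply: low_cat; first exact: low_nseq.
by apply: low_cat; [apply: low_runU | apply: low_runD]; lia.
Qed.

Lemma even_braid_pretzel s t r j k h :
  teq 0 (Cups 0 h.+3 ++ even_braid s t r j k h ++ Caps 0 h.+3)
    (pretzel3 s t r j h.*2.+2 k).
Proof.
apply: teq_trans _ (coil_even_pretzel _ _ _ _ _ _).
have [low lowE] : exists w, w = nseq k (X r, 0) ++ [:: (X (~~ t), 1)] ++ nseq j (X s, 0).
  by eexists.
have hlow : lowX 3 low.
  rewrite lowE; apply: low_cat; first exact: low_nseq.
  by apply: low_cat; [apply: low_X | apply: low_nseq].
have -> v : nseq k (X r, 0) ++ (X (~~ t), 1) :: nseq j (X s, 0) ++ v = low ++ v.
  by rewrite lowE -!catA.
have -> : h.+3 = 3 + h by [].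
rewrite Cups_add Caps_add -(catA (Cups 0 3)); apply: teq_Cups.
apply: teq_trans (_ : teq _ _ (Cups 3 h ++ low ++ coil t 1 h ++ Caps 3 h ++ Caps 0 3)) _.
  apply: teq_Cups; rewrite lowE /even_braid runU_cons /coil -!catA.
  apply: teq_nseq; apply: teq_X.
  (* The block 1^a commutes with all of the first run except its first letter, which exposes a coil
     at position 1. *)
  apply/teq_sym; apply: (@comm _ 2); first exact: low_nseq.
  exact: high_runU.
apply: teq_trans (teq_sym (@comm _ 3 _ _ _ hlow _)) _; first exact: high_Cups.
by apply: (teq_Xs (lowX_isX hlow)); apply: trace_coil.
Qed.

Local Open Scope ring_scope.

Theorem theorem1 :
  (forall a b c : int, ~~ odd `|b|%N -> b != 0 ->
     let h : int := (`|b| %/ 2)%N%:Z in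
     let beta : braid_word :=
       bpow 1 c ++ sscale b (bdown (-2) (- h - 1)) ++ bpow 1 a
       ++ sscale b (bup 2 h ++ bup (- h - 1) (-2)) in
     let n : nat := (`|b| %/ 2 + 2)%N in
     is_closure (pretzel [:: a; b; c]) n beta /\
     size beta = (`|a| + `|c| + (3 * `|b|) %/ 2 - 1)%N)
  /\
  (forall a b c : int, odd `|a|%N -> odd `|b|%N -> odd `|c|%N ->
     let a' : nat := ((`|a| - 1) %/ 2)%N in
     let b' : nat := ((`|b| - 1) %/ 2)%N in
     let c' : nat := ((`|c| - 1) %/ 2)%N in
     let A : int := a'%:Z in
     let B : int := b'%:Z in
     let C : int := c'%:Z in
     let beta : braid_word :=
       shift_up bdown (B + C + 2) (B + 3) a'
       ++ sscale a (bdown (- B - 2) (- B - A - 1) ++ bup (B + 1) (B + A)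
                    ++ bup (- B - A - 1) (- B - 1))
       ++ shift_down bup (- B - A - 2) (- B - 3) c'
       ++ sscale b (bup (- B) (-1) ++ bdown (-1) (- B - 1) ++ bup 1 B)
       ++ sscale c (bdown (- B - 2) (- B - C - 1) ++ bup (B + 1) (B + C)
                    ++ bup (- B - C - 1) (- B - 1)) in
     let n : nat := ((`|a| + `|b| + `|c| + 1) %/ 2)%N in
     is_closure (pretzel [:: a; b; c]) n beta /\
     size beta = (`|a| + `|c| - 1 + (3 * `|b| + absz (a * c)%R) %/ 2)%N).
Proof.
split=> [a b c b_even b_neq0 h beta n | a b c a_odd b_odd c_odd a' b' c' A B C beta n].
  (* The coil closes [k] strands and yields 2k+1 crossings; the remaining crossing of the column is
     the first letter of the first b-run. *)
  pose k := (`|b| %/ 2).-1.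
  have bE : `|b|%N = k.*2.+2 by rewrite /k; lia.
  have betaE : beta = [seq enc g | g <- even_braid (0 < a) (0 < b) (0 < c) `|a| `|c| k].
    rewrite /beta !bpow1_enc (@bdown_neg _ _ 1 k.+1); try lia.
    rewrite (@bup_pos 2 h 1 k); try lia.
    rewrite (@bup_neg _ _ 1 k.+1); try lia.
    rewrite /even_braid /sscale !map_cat -!/(sscale b _) /runU /runD !sscale_enc.
    by case: (0 < b).
  have -> : n = k.+3 by rewrite /n; lia.
  split; last first.
    rewrite betaE size_map /even_braid !size_cat !(size_runU, size_runD, size_nseq); lia.
  rewrite betaE; apply: is_closure_enc; first exact: low_even_braid.
  rewrite bE; exact: even_braid_pretzel.
have aE : `|a|%N = a'.*2.+1 by rewrite /a'; lia.
have bE : `|b|%N = b'.*2.+1 by rewrite /b'; lia.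
have cE : `|c|%N = c'.*2.+1 by rewrite /c'; lia.
have betaE : beta = [seq enc g | g <- odd_braid (0 < a) (0 < b) (0 < c) a' b' c'].
  rewrite /beta (@shift_up_enc _ _ b'.+2 a' c'); try lia.
  rewrite (@coil_enc a _ _ _ _ _ _ b' a'); try lia.
  rewrite (@shift_down_enc _ _ b'.+2 a' c'); try lia.
  rewrite (@spiral_enc b _ _ _ _ _ _ b'); try lia.
  rewrite (@coil_enc c _ _ _ _ _ _ b' c'); try lia.
  by rewrite /odd_braid !map_cat -!catA.
have -> : n = (a' + b' + c').+2 by rewrite /n; lia.
split; last first.
  (* Both 3|b| and |ac| are odd, so the division by 2 is exact. *)
  rewrite betaE size_map size_odd_braid abszM aE bE cE; nia.
rewrite betaE; apply: is_closure_enc; first exact: low_odd_braid.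
rewrite aE bE cE; exact: odd_braid_pretzel.
Qed.
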